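(* Let $p\ge 5$ be a prime, $m\ge 1$ an integer, and $q=p^m$ with $q\equiv 2\pmod 3$. Let $G_{\mathrm{AGM}}$ be the cubic AGM graph over $\mathbb{F}_q$ with vertex set $V_{\mathrm{AGM}}$, and let $G_\rho$ be the $\rho$-graph with vertex set $V_\rho=\mathbb{F}_q\setminus\{1\}$. For the map $$\pi:V_{\mathrm{AGM}}\longrightarrow V_\rho,\qquad (u,v)\longmapsto u/v,$$ the following hold. 1. By sending each edge $(u,v)\to(u',v')$ of $G_{\mathrm{AGM}}$ to $\pi(u,v)\to\pi(u',v')$, the map $\pi$ defines a $(q-1)$-fold covering of digraphs $\pi:G_{\mathrm{AGM}}\to G_\rho$. For each $\rho\in V_\rho$, its fiber is $\pi^{-1}(\rho)=\{(\rho v,v)\mid v\in\mathbb{F}_q^\times\}$. 2. For a simple directed cycle $C=(\rho_0\to\rho_1\to\cdots\to\rho_{L-1}\to\rho_0)$ of length $L$ in $G_\rho$, put $$\kappa_C:=\prod_{i=0}^{L-1}\vartheta(\rho_i),$$ and let $m_C$ be the order of $\kappa_C$ in $\mathbb{F}_q^\times$, i.e. the least positive integer with $\kappa_C^{m_C}=1$. The multiplier $\kappa_C$ does not depend on the starting vertex of $C$. The subdigraph $\pi^{-1}(C)$ of $G_{\mathrm{AGM}}$ consisting of the preimages of the vertices and edges of $C$ is a disjoint union of $(q-1)/m_C$ cycles of length $Lm_C$.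
   Context: Since $q\equiv 2\pmod 3$, every element of $\mathbb{F}_q$ has a unique cube root in $\mathbb{F}_q$. The cubic AGM graph $G_{\mathrm{AGM}}$ over $\mathbb{F}_q$ is the directed graph with vertex set $V_{\mathrm{AGM}}=\{(u,v)\in\mathbb{F}_q^2\mid v\ne 0,\ u^3\ne v^3\}$ and with a directed edge $(u,v)\to(u',v')$ between vertices exactly when $u'=\frac{u+2v}{3}$ and $v'^3=\frac{v(u^2+uv+v^2)}{3}$; each vertex has exactly one outgoing edge. For $\rho\in V_\rho:=\mathbb{F}_q\setminus\{1\}$, $\vartheta(\rho)\in\mathbb{F}_q^\times$ denotes the unique element with $\vartheta(\rho)^3=\frac{\rho^2+\rho+1}{3}$ (which is nonzero), and $f(\rho):=\frac{\rho+2}{3\vartheta(\rho)}$; this defines a map $f:V_\rho\to V_\rho$. The $\rho$-graph is the digraph $G_\rho=(V_\rho,E_\rho)$ with $E_\rho=\{(\rho,f(\rho))\mid\rho\in V_\rho\}$. A covering of digraphs is a digraph morphism, surjective on vertices, which for every vertex $x$ of the source maps the set of outgoing edges at $x$ bijectively onto the set of outgoing edges at its image, and likewise for incoming edges. It is $(q-1)$-fold if each vertex of the target has exactly $q-1$ vertices in its fiber. Cycles that differ only in their starting vertex are identified, and loops are cycles of length $1$. *)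

(* Defs.v *)
From HB Require Import structures.
From mathcomp Require Import all_boot all_order all_fingroup all_algebra all_solvable.
From mathcomp Require Import all_field.
From mathcomp Require Import ring.

Set Implicit Arguments.
Unset Strict Implicit.
Unset Printing Implicit Defensive.

Import GRing.Theory.
Local Open Scope ring_scope.

(* A digraph (loops allowed, no multiple edges) is a relation [e : rel T] on  *)
(* a finite type; its edges are the pairs [a] such that [e a.1 a.2].          *)

Section Digraphs.

Definition out_edges (T : finType) (e : rel T) (x : T) : {set T * T} :=
  [set a : T * T | e a.1 a.2 & a.1 == x].

Definition in_edges (T : finType) (e : rel T) (x : T) : {set T * T} :=
  [set a : T * T | e a.1 a.2 & a.2 == x].

Definition edge_map (S T : Type) (h : S -> T) (a : S * S) : T * T :=
  (h a.1, h a.2).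

Definition maps_bijectively (S T : finType) (h : S -> T)
    (A : {set S}) (B : {set T}) : Prop :=
  {in A &, injective h} /\ h @: A = B.

Definition digraph_covering (S T : finType) (eS : rel S) (eT : rel T)
    (h : S -> T) : Prop :=
  [/\ {homo h : x y / eS x y >-> eT x y},
      forall y : T, exists x : S, h x = y,
      forall x : S, maps_bijectively (edge_map h)
                      (out_edges eS x) (out_edges eT (h x))
    & forall x : S, maps_bijectively (edge_map h)
                      (in_edges eS x) (in_edges eT (h x))].

Definition fold_digraph_covering (k : nat) (S T : finType)
    (eS : rel S) (eT : rel T) (h : S -> T) : Prop :=
  digraph_covering eS eT h /\ forall y : T, #|h @^-1: [set y]| = k.

(* A cycle is represented by the list of its vertices from some starting      *)
(* vertex; two lists represent the same cycle when they agree up to [rot].    *)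
Definition simple_cycle (T : finType) (e : rel T) (c : seq T) : bool :=
  [&& c != [::], path.cycle e c & uniq c].

Record subdigraph (T : finType) := Subdigraph {
  sub_vertices : {set T};
  sub_edges : {set T * T}
}.

Definition cycle_subdigraph (T : finType) (c : seq T) : subdigraph T :=
  Subdigraph [set x in c] [set (x, next c x) | x in c].

Definition preim_subdigraph (S T : finType) (eS : rel S) (h : S -> T)
    (H : subdigraph T) : subdigraph S :=
  Subdigraph (h @^-1: sub_vertices H)
             [set a : S * S | eS a.1 a.2 & edge_map h a \in sub_edges H].

Definition is_disjoint_union (T : finType) (H : subdigraph T)
    (Hs : seq (subdigraph T)) : Prop :=
  [/\ pairwise (fun K K' => [disjoint sub_vertices K & sub_vertices K']) Hs,
      sub_vertices H = \bigcup_(K <- Hs) sub_vertices K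
    & sub_edges H = \bigcup_(K <- Hs) sub_edges K].

End Digraphs.

Section CubicAGM.

Variable F : finFieldType.

Record agm_vertex := AgmVertex {
  agm_pair : F * F;
  _ : (agm_pair.2 != 0) && (agm_pair.1 ^+ 3 != agm_pair.2 ^+ 3)
}.
HB.instance Definition _ := [isSub for agm_pair].
HB.instance Definition _ := [Finite of agm_vertex by <:].

Definition agm_edge : rel agm_vertex := fun w w' =>
  let: (u, v) := val w in
  let: (u', v') := val w' in
  (u' == (u + 2 * v) / 3) &&
  (v' ^+ 3 == v * (u ^+ 2 + u * v + v ^+ 2) / 3).

Record rho_vertex := RhoVertex { rho_val : F; _ : rho_val != 1 }.
HB.instance Definition _ := [isSub for rho_val].
HB.instance Definition _ := [Finite of rho_vertex by <:].

(* The default value [1] is never used when #|F| = 2 %[mod 3]: see            *)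
(* [theta_cube] and [theta_unique].                                           *)
Definition theta (r : rho_vertex) : {unit F} :=
  odflt 1%g [pick t : {unit F} |
    val t ^+ 3 == (val r ^+ 2 + val r + 1) / 3].

Definition rho_map_val (r : rho_vertex) : F :=
  (val r + 2) / (3 * val (theta r)).

Lemma rho_map_val_neq1 (r : rho_vertex) : rho_map_val r != 1.
Proof.
rewrite /rho_map_val; have [n3|n3] := eqVneq (3 : F) 0.
  by rewrite n3 mul0r invr0 mulr0 eq_sym oner_eq0.
have r1 : (val r - 1 == 0) = false by rewrite subr_eq0 (negPf (valP r)).
have t0 : val (theta r) != 0 by rewrite -unitfE (valP (theta r)).
apply/eqP => /(canRL (mulfVK (mulf_neq0 n3 t0))); rewrite mul1r.
rewrite /theta; case: pickP => [t /eqP t3 | _] /= e.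
  have : (val r - 1) ^+ 3 = (val r + 2) ^+ 3 - 9 * (3 * val t ^+ 3).
    by rewrite t3; field.
  have -> : val r + 2 = 3 * val t := e.
  rewrite [RHS](_ : _ = 0); last by ring.
  by apply/eqP; rewrite expf_eq0 /= r1.
move/negbT/eqP: r1; apply; have {}e : val r + 2 = 3 * 1 := e.
by rewrite -[val r](addrK 2) e; ring.
Qed.

Definition rho_map (r : rho_vertex) : rho_vertex :=
  Sub (rho_map_val r) (rho_map_val_neq1 r).

Definition rho_edge : rel rho_vertex := fun r r' => r' == rho_map r.

Lemma agm_proj_neq1 (w : agm_vertex) : (val w).1 / (val w).2 != 1.
Proof.
have /andP[v0] := valP w; apply: contra => /eqP /(canRL (mulfVK v0)) ->.
by rewrite mul1r.
Qed.

Definition agm_proj (w : agm_vertex) : rho_vertex :=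
  Sub ((val w).1 / (val w).2) (agm_proj_neq1 w).

Definition multiplier (C : seq rho_vertex) : {unit F} :=
  (\prod_(r <- C) theta r)%g.

Hypothesis F_mod3 : #|F| = 2 %[mod 3].

Lemma cube_root_exists (x : F) : exists y : F, y ^+ 3 = x.
Proof.
exists (x ^+ (#|F| %/ 3).*2.+1); rewrite -exprM.
have -> : ((#|F| %/ 3).*2.+1 * 3 = #|F| + (#|F|).-1)%N.
  rewrite {2 3}(divn_eq #|F| 3) F_mod3 /= -muln2 mulSn mulnAC muln2 -addnn.
  by rewrite !addnS !addn0 /= addnC !addnS addn0.
rewrite exprD expf_card -exprS prednK ?expf_card //.
by apply/card_gt0P; exists 0.
Qed.

Lemma cube_inj : injective (fun x : F => x ^+ 3).
Proof.
have /fin_all_exists[g gK] := cube_root_exists.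
have g_inj : injective g by apply: (@can_inj _ _ _ (fun x => x ^+ 3)).
move=> x y; rewrite -(f_invF g_inj x) -(f_invF g_inj y) !gK.
by move=> ->.
Qed.

Lemma theta_cube (r : rho_vertex) :
  val (theta r) ^+ 3 = (val r ^+ 2 + val r + 1) / 3.
Proof.
have n3 : (3 : F) != 0.
  apply/eqP => n3; have : (#[1%R : F]%g %| 3)%N by rewrite order_dvdn FinRing.zmodXgE n3.
  rewrite dvdn_divisors // => /predU1P[|/predU1P[]//] o1.
    by move/eqP: o1; rewrite order_eq1 (oner_eq0 F).
  have := order_dvdG (in_setT (1%R : F)); rewrite o1 cardsT.
  by rewrite /dvdn F_mod3.
have nz : val r ^+ 2 + val r + 1 != 0.
  apply: contraNneq (valP r) => z; apply/eqP/cube_inj; apply/eqP.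
  rewrite -subr_eq0 [X in X == _](_ : _ = (val r - 1) * (val r ^+ 2 + val r + 1)).
    by rewrite z mulr0.
  by ring.
rewrite /theta; case: pickP => [t /eqP // | noroot].
have [y y3] := cube_root_exists ((val r ^+ 2 + val r + 1) / 3).
have yU : y \is a GRing.unit.
  by rewrite -(unitrX_pos y (n := 3)) // y3 unitfE mulf_neq0 ?invr_eq0.
by have := noroot (FinRing.unit F yU); rewrite /= y3 eqxx.
Qed.

Lemma theta_unique (r : rho_vertex) (y : F) :
  y ^+ 3 = (val r ^+ 2 + val r + 1) / 3 -> y = val (theta r).
Proof. by rewrite -theta_cube => /cube_inj. Qed.

End CubicAGM.

(* Main.v *)
Require Import Defs.
From mathcomp Require Import all_boot all_order all_fingroup all_algebra.
From mathcomp Require Import cyclic ring.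

Set Implicit Arguments.
Unset Strict Implicit.
Unset Printing Implicit Defensive.

Import GRing.Theory.
Local Open Scope ring_scope.

(* In the coordinates (rho, v) with rho = u / v, the AGM step is the skew     *)
(* product (rho, v) |-> (f rho, theta rho * v) over the rho-graph. Both f and *)
(* the AGM step are injective, so both digraphs are disjoint unions of        *)
(* cycles. Going once around a cycle C multiplies v by the multiplier of C,   *)
(* so a vertex above C first returns to itself after L * m_C steps; as        *)
(* L * (q - 1) vertices lie above C, they form (q - 1) / m_C cycles.          *)

(** Both digraphs are graphs of injective maps on finite sets, and [agm_proj] intertwines these
    maps. Each vertex thus has exactly one edge in and one edge out, so [semiconjugacy_covering]
    gives the covering and [card_agm_fiber] its degree. Above a cycle of multiplier kappa, one turn
    sends the fiber coordinate t to t * kappa; [forder_agm_map] deduces that all orbits there have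
    the same length, and [orbit_decomposition] converts the number of vertices into the number of
    cycles. The arithmetic input, behind [rho_map_inj] and [agm_edgeE], is the uniqueness of cube
    roots. *)

Section FunctionalDigraphs.

Variables (T : finType) (f : T -> T).
Hypothesis f_inj : injective f.

Lemma dvdn_forder x n : (fingraph.order f x %| n)%N = (iter n f x == x).
Proof.
have iterM k : iter (k * fingraph.order f x) f x = x.
  by elim: k => // k IHk; rewrite mulSn iterD IHk iter_order.
apply/idP/eqP => [/dvdnP[k ->] //|].
rewrite {1}(divn_eq n (fingraph.order f x)) addnC iterD iterM => fx.
rewrite /dvdn -(@findex_iter _ f x (n %% _)) ?fx ?findex0 //.
by rewrite ltn_mod fingraph.order_gt0.
Qed.

Variable e : rel T.
Hypothesis eE : forall x y, e x y = (y == f x).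

Lemma functional_next c x : path.cycle e c -> x \in c -> next c x = f x.
Proof. by move=> c_e /(next_cycle c_e); rewrite eE => /eqP. Qed.

Lemma functional_cycle c : path.cycle e c = fcycle f c.
Proof. by apply: eq_cycle => x y; rewrite eE /= eq_sym. Qed.

Lemma out_edges_functional x : out_edges e x = [set (x, f x)].
Proof.
apply/setP => -[y z]; rewrite !inE /= eE xpair_eqE andbC.
by case: (y =P x) => // ->.
Qed.

Lemma in_edges_functional x : in_edges e x = [set (finv f x, x)].
Proof.
apply/setP => -[y z]; rewrite !inE /= eE xpair_eqE andbC [RHS]andbC.
by case: (z =P x) => // ->; rewrite /= -(inj_eq f_inj y) f_finv // eq_sym.
Qed.

(** The orbits inside a closed set partition it, and injectivity makes each of them a cycle. The
    common period n turns the number of orbits into a division of the cardinal of A. *)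
Lemma orbit_decomposition (A : {set T}) n :
    fclosed f A -> {in A, forall x, fingraph.order f x = n} ->
  exists Ds : seq (seq T),
    [/\ (size Ds * n)%N = #|A|,
        forall D, D \in Ds -> simple_cycle e D /\ size D = n
      & is_disjoint_union (Subdigraph A [set (x, f x) | x in A])
          [seq cycle_subdigraph D | D <- Ds]].
Proof.
move=> fA An.
have symf := fconnect_sym f_inj.
have orbA x y : x \in A -> y \in fingraph.orbit f x -> y \in A.
  by rewrite -fconnect_orbit => xA /(closed_connect fA) <-.
(* One representative for each orbit contained in A. *)
pose R := [predI froots f & A].
have rootA x : x \in A -> froot f x \in R.
  move=> xA; apply/andP; split; first exact: roots_root.
  by rewrite -(closed_connect fA (connect_root _ x)).
have orb_root x : x \in fingraph.orbit f (froot f x).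
  by rewrite -fconnect_orbit symf connect_root.
have cycle_orb x : path.cycle e (fingraph.orbit f x).
  by rewrite functional_cycle cycle_orbit.
exists [seq fingraph.orbit f x | x <- enum R]; split.
- rewrite size_map -cardE; apply: (fcard_order_set f_inj) => //.
  by apply/subsetP => x /An <-; rewrite !inE.
- move=> _ /mapP[x + ->]; rewrite mem_enum => /andP[_ xA].
  rewrite size_orbit (An _ xA); split=> //.
  rewrite /simple_cycle cycle_orb orbit_uniq -size_eq0 size_orbit -lt0n.
  by rewrite fingraph.order_gt0.
- split=> /=.
  + rewrite -map_comp pairwise_map.
    have := enum_uniq R; rewrite uniq_pairwise.
    apply: (@sub_in_pairwise _ (mem R)) => [x y|]; last first.
      by apply/allP => x; rewrite mem_enum.
    move=> /andP[/eqP rx _] /andP[/eqP ry _] /= /negP nxy.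
    rewrite -setI_eq0; apply/eqP/setP => z; rewrite !inE -!fconnect_orbit.
    apply/negP => /andP[xz yz]; apply: nxy.
    by rewrite -rx -ry root_connect // (connect_trans xz) // symf.
  + rewrite !big_map big_enum /=; apply/setP => x; apply/idP/bigcupP => [xA|].
      by exists (froot f x); rewrite ?rootA // inE.
    by case=> y /andP[_ yA]; rewrite inE; apply: orbA.
  + rewrite !big_map big_enum /=; apply/setP => a; apply/imsetP/bigcupP.
      case=> x xA ->; exists (froot f x); rewrite ?rootA //; apply/imsetP.
      by exists x; rewrite ?functional_next.
    case=> y /andP[_ yA] /imsetP[x xy ->].
    by exists x; [apply: orbA xy | rewrite functional_next].
Qed.

End FunctionalDigraphs.

(** * Semiconjugacies as coverings, and preimages of cycles *)

Section Semiconjugacy.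

Variables (S T : finType) (g : S -> S) (f : T -> T) (h : S -> T).
Hypotheses (g_inj : injective g) (f_inj : injective f).
Hypothesis hg : forall x, h (g x) = f (h x).
Variables (eS : rel S) (eT : rel T).
Hypotheses (eSE : forall x y, eS x y = (y == g x))
           (eTE : forall x y, eT x y = (y == f x)).

Lemma semiconjugacy_covering :
  (forall y, exists x, h x = y) -> digraph_covering eS eT h.
Proof.
move=> h_surj; split=> //.
- by move=> x y; rewrite eSE eTE => /eqP->; rewrite hg.
- move=> x; rewrite (out_edges_functional eSE) (out_edges_functional eTE).
  by split=> [a b /set1P-> /set1P-> //|]; rewrite imset_set1 /edge_map /= hg.
- move=> x; rewrite (in_edges_functional g_inj eSE) (in_edges_functional f_inj eTE).
  split=> [a b /set1P-> /set1P-> //|]; rewrite imset_set1 /edge_map /=.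
  (* That h commutes with the inverse maps is checked after applying f. *)
  by congr [set (_, _)]; apply: f_inj; rewrite -hg !f_finv.
Qed.

Lemma preim_cycle_subdigraph c : path.cycle eT c ->
  preim_subdigraph eS h (cycle_subdigraph c)
  = Subdigraph (h @^-1: [set y in c])
      [set (x, g x) | x in h @^-1: [set y in c]].
Proof.
move=> c_e; congr Subdigraph; apply/setP => -[x x']; rewrite !inE /= eSE.
apply/andP/imsetP => [[/eqP-> /imsetP[y]]|[z]].
  by move=> yc [hx _]; exists x; rewrite // !inE hx.
rewrite !inE => zc [-> ->]; split=> //; apply/imsetP.
by exists (h z); rewrite // /edge_map /= hg (functional_next eTE).
Qed.

Lemma fclosed_preim_fcycle c : fcycle f c -> fclosed g (h @^-1: [set y in c]).
Proof.
move=> f_c; apply: (intro_closed (fconnect_sym g_inj)) => x _ /eqP <-.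
rewrite !inE hg => xc; rewrite (eqP (next_cycle f_c xc)).
by rewrite mem_next.
Qed.

End Semiconjugacy.

(** * Independence of the multiplier from the starting vertex *)

Section Multiplier.

Variable F : finFieldType.

Lemma perm_multiplier (C C' : seq (rho_vertex F)) :
  perm_eq C C' -> multiplier C = multiplier C'.
Proof.
(* The product in the group [{unit F}] is moved to the field, where factors may be permuted. *)
have multiplierE D : val (multiplier D) = \prod_(r <- D) val (theta r).
  elim: D => [|r D IHD]; first by rewrite /multiplier !big_nil.
  by rewrite big_cons -IHD /multiplier big_cons.
by move=> CC'; apply: val_inj; rewrite /= !multiplierE (perm_big C').
Qed.

End Multiplier.

(** * The AGM step as a skew product, and its periods *)

Section CubicAGMCoordinates.

Variable F : finFieldType.
Hypothesis F_mod3 : #|F| = 2 %[mod 3].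

Lemma three_neq0 : (3 : F) != 0.
Proof.
have rho0 : (0 : F) != 1 by rewrite eq_sym oner_eq0.
(* If 3 = 0, then 1 / 3 is 0 by convention, so the unit [theta] at 0 would have cube 0. *)
apply: contraTneq (valP (theta (RhoVertex rho0))) => z3.
have /eqP := theta_cube F_mod3 (RhoVertex rho0).
by rewrite z3 invr0 mulr0 expf_eq0 /= unitfE => /eqP ->; rewrite eqxx.
Qed.

(* With [f] for [rho_map], [f^3 / (f^3 - 1)] at [r] is the cube of the       *)
(* Moebius transform [(r + 2) / (r - 1)] of [r]; hence [f r] determines [r].  *)
Lemma rho_map_inj : injective (@rho_map F).
Proof.
move=> r s /(congr1 val) /=; rewrite /rho_map_val.
have tr : val (theta r) != 0 by rewrite -unitfE (valP (theta r)).
have ts : val (theta s) != 0 by rewrite -unitfE (valP (theta s)).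
have n3 := three_neq0.
move/eqP; rewrite eqr_div ?mulf_neq0 // => /eqP/(congr1 (fun z => z ^+ 3)).
rewrite !exprMn !theta_cube // => cross; apply: val_inj; apply: (mulfI n3).
move: (val r) (val s) cross => x y cross.
(* Comes from [cross] and 9 (x^2 + x + 1) = (x + 2)^3 - (x - 1)^3, likewise for y. *)
have /(cube_inj F_mod3) e : ((x + 2) * (y - 1)) ^+ 3 = ((y + 2) * (x - 1)) ^+ 3.
  apply: subr0_eq; move/eqP: cross; rewrite eq_sym -subr_eq0 => /eqP <-.
  by field.
apply: subr0_eq.
have -> : 3 * x - 3 * y = (y + 2) * (x - 1) - (x + 2) * (y - 1) by ring.
by rewrite e subrr.
Qed.

Lemma agm_lift_subproof (r : rho_vertex F) (t : {unit F}) :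
  (val t != 0) && ((val r * val t) ^+ 3 != val t ^+ 3).
Proof.
have t0 : val t != 0 by rewrite -unitfE (valP t).
rewrite t0 /=; apply: contra (valP r) => /eqP/(cube_inj F_mod3) rt.
by rewrite -(inj_eq (mulIf t0)) mul1r -[X in _ == X]rt.
Qed.

(** Inverse of the coordinates [agm_proj] and [agm_scale]. Taking t in the unit group makes each
    fiber a copy of that group. *)
Definition agm_lift (r : rho_vertex F) (t : {unit F}) : agm_vertex F :=
  @AgmVertex F (val r * val t, val t) (agm_lift_subproof r t).

Lemma agm_liftK r t : agm_proj (agm_lift r t) = r.
Proof.
by apply: val_inj; rewrite /= mulfK //; have /andP[] := agm_lift_subproof r t.
Qed.

Lemma agm_lift_inj r : injective (agm_lift r).
Proof. by move=> t t' /(congr1 val)[_ ?]; apply: val_inj. Qed.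

Lemma agm_scale_subproof (w : agm_vertex F) : (val w).2 \is a GRing.unit.
Proof. by rewrite unitfE; have /andP[] := valP w. Qed.

Definition agm_scale (w : agm_vertex F) : {unit F} :=
  FinRing.unit F (agm_scale_subproof w).

Lemma agm_scaleK w : agm_lift (agm_proj w) (agm_scale w) = w.
Proof.
apply: val_inj; rewrite /= divfK; first by case: (val w).
by have /andP[] := valP w.
Qed.

Lemma agm_lift_scale r t : agm_scale (agm_lift r t) = t.
Proof. exact: val_inj. Qed.

Definition agm_map (w : agm_vertex F) : agm_vertex F :=
  agm_lift (rho_map (agm_proj w)) (agm_scale w * theta (agm_proj w))%g.

(** Substituting u = r t and v = t makes the cubic expression equal to (t * theta r)^3, whose only
    cube root is t * theta r. *)
Lemma agm_edgeE w w' : agm_edge w w' = (w' == agm_map w).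
Proof.
rewrite -{1}(agm_scaleK w) /agm_map.
move: (agm_proj w) (agm_scale w) => r t; case: w' => -[u' v'] w'P.
rewrite -val_eqE /agm_edge /= xpair_eqE andbC [RHS]andbC.
have t0 : val t != 0 by rewrite -unitfE (valP t).
have th0 : val (theta r) != 0 by rewrite -unitfE (valP (theta r)).
have -> : val t * ((val r * val t) ^+ 2 + val r * val t * val t + val t ^+ 2) / 3
          = (val t * val (theta r)) ^+ 3.
  by rewrite [RHS]exprMn theta_cube //; ring.
have -> : (val r * val t + 2 * val t) / 3
          = rho_map_val r * (val t * val (theta r)).
  by rewrite /rho_map_val; field; rewrite th0 three_neq0.
by rewrite (inj_eq (cube_inj F_mod3)).
Qed.

Lemma agm_proj_map w : agm_proj (agm_map w) = rho_map (agm_proj w).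
Proof. exact: agm_liftK. Qed.

(** The base point is recovered by [rho_map_inj], the scale by cancelling [theta]. *)
Lemma agm_map_inj : injective agm_map.
Proof.
move=> w w' ww'; rewrite -(agm_scaleK w) -(agm_scaleK w').
have pww' : agm_proj w = agm_proj w'.
  by apply: rho_map_inj; rewrite -!agm_proj_map ww'.
congr agm_lift => //; apply: (mulIg (theta (agm_proj w))).
by have /(congr1 agm_scale) := ww'; rewrite !agm_lift_scale pww'.
Qed.

Lemma iter_agm_map n r t :
  iter n agm_map (agm_lift r t)
  = agm_lift (iter n (@rho_map F) r)
      (t * multiplier (traject (@rho_map F) r n))%g.
Proof.
elim: n => [|n IHn]; first by rewrite /multiplier big_nil mulg1.
rewrite iterS IHn /agm_map agm_liftK agm_lift_scale trajectSr.
by rewrite /multiplier big_rcons mulgA.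
Qed.

Lemma agm_fiber r : @agm_proj F @^-1: [set r] = [set agm_lift r t | t : {unit F}].
Proof.
apply/setP => w; rewrite !inE; apply/eqP/imsetP => [<-|[t _ ->]].
  by exists (agm_scale w); rewrite ?agm_scaleK.
exact: agm_liftK.
Qed.

Lemma card_agm_fiber r : #|@agm_proj F @^-1: [set r]| = (#|F| - 1)%N.
Proof.
by rewrite agm_fiber (card_imset _ (@agm_lift_inj r)) -cardsT card_finField_unit subn1.
Qed.

Lemma card_agm_preim (A : {set rho_vertex F}) :
  #|@agm_proj F @^-1: A| = (#|A| * (#|F| - 1))%N.
Proof.
rewrite -sum1_card (partition_big (@agm_proj F) (mem A)) /=; last first.
  by move=> w; rewrite inE.
rewrite -sum_nat_const; apply: eq_bigr => r rA.
rewrite -(card_agm_fiber r) -sum1_card; apply: eq_bigl => w.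
by rewrite !inE andbC; case: eqP => // ->.
Qed.

Lemma forder_agm_map C w : fcycle (@rho_map F) C -> uniq C ->
  agm_proj w \in C ->
  fingraph.order agm_map w = (size C * #[multiplier C]%g)%N.
Proof.
move=> f_C C_uniq; rewrite -{2}(agm_scaleK w).
move: (agm_proj w) (agm_scale w) => r t rC.
have ordr : fingraph.order (@rho_map F) r = size C by apply: order_cycle.
have fixr : iter (size C) (@rho_map F) r = r.
  by rewrite -ordr (iter_order rho_map_inj).
(* One turn starting at r lists a rotation of C. *)
have multr : multiplier (traject (@rho_map F) r (size C)) = multiplier C.
  rewrite -ordr -/(fingraph.orbit _ r) (fingraph.orbitE f_C) //.
  by apply: perm_multiplier; rewrite perm_rot.
have iterL k : iter (k * size C) agm_map (agm_lift r t)
               = agm_lift r (t * multiplier C ^+ k)%g.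
  elim: k => [|k IHk]; first by rewrite mulg1.
  by rewrite mulSn iterD IHk iter_agm_map fixr multr -mulgA -expgSr.
apply/eqP; rewrite eqn_dvd; apply/andP; split.
  by rewrite (dvdn_forder agm_map_inj) mulnC iterL expg_order mulg1.
(* A return upstairs projects to a return in C, so it takes k full turns; then kappa^k = 1. *)
have : (size C %| fingraph.order agm_map (agm_lift r t))%N.
  rewrite -ordr (dvdn_forder rho_map_inj); apply/eqP.
  have := congr1 (@agm_proj F) (iter_order agm_map_inj (agm_lift r t)).
  by rewrite iter_agm_map !agm_liftK.
case/dvdnP=> k ordk; rewrite ordk mulnC dvdn_mul // order_dvdn.
have := iter_order agm_map_inj (agm_lift r t).
rewrite ordk iterL => /agm_lift_inj e; apply/eqP.
by apply: (mulgI t); rewrite e mulg1.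
Qed.

End CubicAGMCoordinates.

Theorem theorem5p6 (p m q : nat) (F : finFieldType)
    (p_prime : prime p) (p_ge5 : (5 <= p)%N) (m_ge1 : (1 <= m)%N)
    (q_def : q = (p ^ m)%N) (q_mod3 : q = 2 %[mod 3]) (card_F : #|F| = q) :
  (* 1: (q-1)-fold covering, with explicit fibers *)
  (fold_digraph_covering (q - 1) (@agm_edge F) (@rho_edge F) (@agm_proj F)
   /\ forall r : rho_vertex F,
        [set val w | w in @agm_proj F @^-1: [set r]]
        = [set (val r * v, v) | v in [set v : F | v != 0]])
  (* 2: preimages of simple cycles *)
  /\ forall C : seq (rho_vertex F), simple_cycle (@rho_edge F) C ->
      (forall k : nat, multiplier (rot k C) = multiplier C)
      /\ (#[multiplier C]%g %| q - 1)%N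
      /\ exists Ds : seq (seq (agm_vertex F)),
           [/\ size Ds = ((q - 1) %/ #[multiplier C]%g)%N,
               forall D, D \in Ds ->
                 simple_cycle (@agm_edge F) D
                 /\ size D = (size C * #[multiplier C]%g)%N
             & is_disjoint_union
                 (preim_subdigraph (@agm_edge F) (@agm_proj F)
                    (cycle_subdigraph C))
                 [seq cycle_subdigraph D | D <- Ds]].
Proof.
have F_mod3 : #|F| = 2 %[mod 3] by rewrite card_F.
have edgeE := agm_edgeE F_mod3; have map_inj := @agm_map_inj F F_mod3.
have f_inj := rho_map_inj F_mod3; have projM := agm_proj_map F_mod3.
have rhoE x y : @rho_edge F x y = (y == rho_map x) by [].
split; last move=> C /and3P[C_nil C_cycle C_uniq].
  split; [split|].
  - apply: (semiconjugacy_covering map_inj f_inj projM edgeE rhoE) => r.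
    by exists (agm_lift F_mod3 r 1%g); rewrite agm_liftK.
  - by move=> r; rewrite card_agm_fiber // card_F.
  move=> r; rewrite (agm_fiber F_mod3) -imset_comp; apply/setP => a.
  apply/imsetP/imsetP => [[t _ ->]|[v]].
    by exists (val t); rewrite // inE -unitfE (valP t).
  by rewrite inE -unitfE => vU ->; exists (FinRing.unit F vU).
have f_C : fcycle (@rho_map F) C by rewrite -(functional_cycle rhoE).
have C_gt0 : (0 < size C)%N by rewrite lt0n size_eq0.
split; first by move=> k; apply: perm_multiplier; rewrite perm_rot.
split; first by rewrite -card_F subn1 -card_finField_unit order_dvdG ?in_setT.
rewrite (preim_cycle_subdigraph projM edgeE rhoE) //.
have [|Ds [Ds_size Ds_cycle Ds_union]] := orbit_decomposition map_inj edgeE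
    (fclosed_preim_fcycle map_inj projM f_C) (n := (size C * #[multiplier C]%g)%N).
  by move=> w; rewrite !inE; apply: forder_agm_map.
exists Ds; split=> //; move/eqP: Ds_size.
(* Both sides count the vertices above C; cancelling [size C] leaves [size Ds] times the order of
   the multiplier equal to q - 1. *)
rewrite card_agm_preim // card_F cardsE (card_uniqP C_uniq) mulnCA.
rewrite eqn_pmul2l // => /eqP <-.
by rewrite mulnK ?order_gt0.
Qed.
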